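(* Let $P$ be a simple polytope and $\mathbf{c}$ a generic cost vector such that $G(P,\mathbf{c})$ is the Hasse diagram of a lattice $L$. Let $F$ be a 2-dimensional face of $P$ with source $u$, and let $x,y\in F$ be vertices both covering $u$ in $L$. Then the pseudo-join of $x,y$ (the sink of the smallest face of $P$ containing $u,x,y$) equals $x\vee y$. Likewise, for any 2-face $F'$ with sink $v$ and vertices $x',y'\in F'$ both covered by $v$ in $L$, the pseudo-meet of $x',y'$ (the source of the smallest face containing $v,x',y'$) equals $x'\wedge y'$.
   Context: A polytope is simple if for each vertex $v$ and each set of $i$ edges at $v$ there is an $i$-dimensional face containing $v$ and those edges. $\mathbf{c}$ is generic if it takes distinct values on distinct vertices of $P$. $G(P,\mathbf{c})$ is the 1-skeleton of $P$ with each edge oriented from the endpoint with smaller $\mathbf{c}$-value to the one with larger $\mathbf{c}$-value. The Hasse diagram of a finite poset has a directed edge $a\to b$ iff $b$ covers $a$. The source (resp. sink) of a face is its vertex minimizing (resp. maximizing) $\mathbf{c}\cdot x$. *)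

(* Defs.v *)
From HB Require Import structures.
From mathcomp Require Import all_boot all_order all_algebra.
From mathcomp Require Import boolp classical_sets functions cardinality reals.

Set Implicit Arguments.
Unset Strict Implicit.
Unset Printing Implicit Defensive.

Import Order.TTheory GRing.Theory Num.Theory.

Local Open Scope classical_set_scope.
Local Open Scope ring_scope.

Section Polytopes.
Variables (R : realType) (n : nat).
Implicit Types (A E F G P : set 'rV[R]_n) (a c x v w s : 'rV[R]_n).

Definition dot c x : R := \sum_(i < n) c 0 i * x 0 i.

Definition conv_hull A : set 'rV[R]_n :=
  [set x | exists (m : nat) (l : 'I_m -> R) (p : 'I_m -> 'rV[R]_n),
    [/\ forall i, A (p i), forall i, 0 <= l i, \sum_i l i = 1 &
        x = \sum_i l i *: p i]].

Definition aff_hull A : set 'rV[R]_n :=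
  [set x | exists (m : nat) (l : 'I_m -> R) (p : 'I_m -> 'rV[R]_n),
    [/\ forall i, A (p i), \sum_i l i = 1 & x = \sum_i l i *: p i]].

(* The empty set has no dimension in this sense. *)
Definition has_dim A (k : nat) : Prop :=
  exists x (U : {vspace 'rV[R]_n}),
    \dim U = k /\ aff_hull A = [set y | y - x \in U].

Definition polytope P : Prop :=
  exists2 A, finite_set A & P = conv_hull A.

(* [a = 0] gives the improper faces: [P] itself ([b = 0]) and the empty face
   ([b = 1]). *)
Definition face P F : Prop :=
  exists a (b : R), (forall x, P x -> dot a x <= b) /\
    F = [set x | P x /\ dot a x = b].

Definition face_of_dim P (k : nat) F : Prop := face P F /\ has_dim F k.

Definition vertex P v : Prop := face P [set v].

Definition simple P : Prop :=
  forall v, vertex P v ->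
  forall (i : nat) (S : set (set 'rV[R]_n)),
    (forall E, S E -> face_of_dim P 1 E /\ E v) -> (S #= `I_i)%card ->
    exists F, [/\ face_of_dim P i F, F v & forall E, S E -> E `<=` F].

Definition generic P c : Prop :=
  forall v w, vertex P v -> vertex P w -> v <> w -> dot c v <> dot c w.

(* The arcs of G(P, c); the endpoints of an edge [E] are the vertices of [E]. *)
Definition arc P c v w : Prop :=
  exists E, [/\ face_of_dim P 1 E, vertex E v, vertex E w & dot c v < dot c w].

Definition source c F s : Prop :=
  vertex F s /\ forall x, F x -> dot c s <= dot c x.

Definition sink c F s : Prop :=
  vertex F s /\ forall x, F x -> dot c x <= dot c s.

Definition smallest_face P A G : Prop :=
  [/\ face P G, A `<=` G & forall G', face P G' -> A `<=` G' -> G `<=` G'].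

(* The smallest face containing given points of a polytope exists and is unique,
   and so are its source and sink when [c] is generic; the two predicates below
   assert this existence and say that [s] is the point so determined. *)
Definition pseudo_join P c u x y s : Prop :=
  exists2 G, smallest_face P [set u; x; y] G & sink c G s.

Definition pseudo_meet P c v x y s : Prop :=
  exists2 G, smallest_face P [set v; x; y] G & source c G s.

End Polytopes.

Definition covers (d : Order.disp_t) (L : porderType d) (b a : L) : Prop :=
  (a < b)%O /\ forall z : L, ~ ((a < z)%O /\ (z < b)%O).

(* [phi] is a digraph isomorphism from the Hasse diagram of [L] onto G(P, c). *)
Definition hasse_iso (R : realType) (n : nat) (P : set 'rV[R]_n)
    (c : 'rV[R]_n) (d : Order.disp_t) (L : porderType d)
    (phi : L -> 'rV[R]_n) : Prop :=
  set_bij [set: L] [set v | vertex P v] phi /\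
  forall a b : L, covers b a <-> arc P c (phi a) (phi b).

(* Main.v *)
(* Induct downwards on [u]. Let [w] be the sink of the polygon [F]; climbing
   along the two sides of [F] gives [x \/ y <= w]. If a vertex [a <> u] of [F]
   had an upper cover [g <= w] outside [F], then, [b] being the upper neighbour of
   [a] in [F], the 2-face spanned by [b] and [g] at [a] would by induction have
   sink [b \/ g <= w], and so would contain an upper cover of [b] below [w] and
   outside [F]; climbing on, there would be one at [w], which is absurd. Hence the
   intervals [[x, w]] and [[y, w]] lie in [F]. Then [x \/ y] is in [F] and has
   lower covers in [F] above [x] and above [y], which are distinct by minimality
   of the join; a vertex of a polygon whose two edges both descend is its sink.
   Meets follow by reversing [c] and [L]. *)
Require Import Defs.
From HB Require Import structures.
From mathcomp Require Import all_boot all_order all_algebra.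
From mathcomp Require Import boolp classical_sets functions cardinality reals.
From mathcomp Require Import lra.

Set Implicit Arguments.
Unset Strict Implicit.
Unset Printing Implicit Defensive.

Import Order.TTheory GRing.Theory Num.Theory.

Local Open Scope classical_set_scope.
Local Open Scope ring_scope.

(** * Linear functionals, convex combinations and faces *)

Section Geometry.
Variables (R : realType) (n : nat).
Implicit Types (A E F G P : set 'rV[R]_n) (c f g p q v w x y : 'rV[R]_n).

Lemma dotDr f x y : dot f (x + y) = dot f x + dot f y.
Proof. by rewrite /dot -big_split; apply: eq_bigr => i _; rewrite mxE mulrDr. Qed.

Lemma dotZr f k x : dot f (k *: x) = k * dot f x.
Proof. by rewrite /dot mulr_sumr; apply: eq_bigr => i _; rewrite mxE mulrCA. Qed.

Lemma dotDl f g x : dot (f + g) x = dot f x + dot g x.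
Proof. by rewrite /dot -big_split; apply: eq_bigr => i _; rewrite mxE mulrDl. Qed.

Lemma dotZl k f x : dot (k *: f) x = k * dot f x.
Proof. by rewrite /dot mulr_sumr; apply: eq_bigr => i _; rewrite mxE mulrA. Qed.

Lemma dotNl f x : dot (- f) x = - dot f x.
Proof. by rewrite -scaleN1r dotZl mulN1r. Qed.

Lemma dotBr f x y : dot f (x - y) = dot f x - dot f y.
Proof. by rewrite -scaleN1r dotDr dotZr mulN1r. Qed.

Lemma dot_sumr f m (l : 'I_m -> R) (p : 'I_m -> 'rV[R]_n) :
  dot f (\sum_i l i *: p i) = \sum_i l i * dot f (p i).
Proof.
have dot0 : dot f 0 = 0 by rewrite -(scale0r 0) dotZr mul0r.
by rewrite (big_morph _ (dotDr f) dot0); apply: eq_bigr => i _; exact: dotZr.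
Qed.

Lemma slack_sum f b m (l : 'I_m -> R) (p : 'I_m -> 'rV[R]_n) :
  \sum_i l i = 1 ->
  b - dot f (\sum_i l i *: p i) = \sum_i l i * (b - dot f (p i)).
Proof.
move=> l1; rewrite dot_sumr -[in LHS](mul1r b) -l1 mulr_suml -sumrB.
by apply: eq_bigr => i _; rewrite mulrBr.
Qed.

(** The slack of the combination is a sum of nonnegative terms [l i * (b - dot f (p i))], so it
    vanishes only if each term does. Hence a point of a face only involves generators of that face,
    up to zero weights. *)
Lemma conv_slack_eq0 f b m (l : 'I_m -> R) (p : 'I_m -> 'rV[R]_n) :
  (forall i, 0 <= l i) -> \sum_i l i = 1 -> (forall i, dot f (p i) <= b) ->
  dot f (\sum_i l i *: p i) = b -> forall i, l i = 0 \/ dot f (p i) = b.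
Proof.
move=> l0 l1 fp /eqP; rewrite eq_sym -subr_eq0 slack_sum // psumr_eq0.
  move=> /allP z i; have := z i (mem_index_enum i); rewrite mulf_eq0 subr_eq0.
  by move=> /orP[/eqP|/eqP/esym]; [left|right].
by move=> i _; rewrite mulr_ge0 // subr_ge0.
Qed.

Lemma sub_conv_hull A : A `<=` conv_hull A.
Proof.
move=> x Ax; exists 1%N, (fun=> 1), (fun=> x).
by split=> //; rewrite ?big_ord1 ?scale1r.
Qed.

Lemma face_sub P F : face P F -> F `<=` P.
Proof. by move=> [f [b [_ ->]]] x []. Qed.

Lemma face_restrict P F G : face P G -> F `<=` P -> G `<=` F -> face F G.
Proof.
move=> [f [b [fP ->]]] FP GF; exists f, b; split=> [x /FP /fP //|].
apply/seteqP; split=> x /=; first by move=> Gx; split; [exact: GF|case: Gx].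
by move=> [/FP].
Qed.

Lemma vertex_restrict P F v : vertex P v -> F `<=` P -> F v -> vertex F v.
Proof. by move=> Pv FP Fv; apply: face_restrict Pv FP _ => x ->. Qed.

Lemma vertex_functional P v : vertex P v ->
  exists f, forall x, P x -> dot f x <= dot f v /\ (dot f x = dot f v -> x = v).
Proof.
move=> [f [b [fP E]]]; exists f => x Px.
have [Pv fv] : [set x | P x /\ dot f x = b] v by rewrite -E.
rewrite fv; split; first exact: fP.
by move=> fx; have : [set v] x by rewrite E.
Qed.

Lemma vertex_in P v : vertex P v -> P v.
Proof. by move=> /face_sub; apply. Qed.

(* Replaces the statement that [F] is the convex hull of [A `&` F]. *)
Lemma face_dot_le A F f b : face (conv_hull A) F ->
  (forall x, A x -> F x -> dot f x <= b) -> forall x, F x -> dot f x <= b.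
Proof.
move=> [g [h [gP FE]]] fb x; rewrite FE => -[[m [l [p [Ap l0 l1 ->]]]]].
have Pp i : conv_hull A (p i) by exact: sub_conv_hull.
move=> /(conv_slack_eq0 l0 l1 (fun i => gP _ (Pp i))) z.
rewrite -subr_ge0 slack_sum //; apply: sumr_ge0 => i _.
have [->|gp] := z i; first by rewrite mul0r.
by rewrite mulr_ge0 // subr_ge0 fb // FE.
Qed.

(** Tilt the functional [f] of [F] by that of [G]: for large [N], [g + N *: f] is maximal on [P]
    exactly along [G]. One [N] serves all of [P] because [P] has finitely many generators. *)
Lemma face_trans P F G : polytope P -> face P F -> face F G -> face P G.
Proof.
move=> [A finA PE] [f [b [fP FE]]] [g [h [gF GE]]].
have AP x : A x -> P x by rewrite PE; exact: sub_conv_hull.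
have [N NA] : exists N, forall x, A x -> dot f x < b ->
    dot g x - h < N * (b - dot f x).
  move: finA => /finite_seqP[s ->]; elim: s => [|p s [N Ns]].
    by exists 0.
  (* The added 1 makes the inequality strict at the new generator [p]; enlarging [N] keeps it at the
     earlier ones, whose slack is positive. *)
  exists (Num.max N ((dot g p - h) / (b - dot f p) + 1)) => x /=.
  rewrite inE => /orP[/eqP->|xs] fx.
    rewrite -ltr_pdivrMr ?subr_gt0 // lt_max; apply/orP; right.
    by rewrite ltrDl.
  apply: lt_le_trans (Ns x xs fx) _.
  by rewrite ler_pM2r ?subr_gt0 // le_max lexx.
(* A generator in [F] has zero slack for [f], and the bound is that of [g]; off [F] the choice of
   [N] makes it strict. *)
have slA x : A x -> dot (g + N *: f) x <= h + N * b /\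
    (dot (g + N *: f) x = h + N * b -> dot f x = b /\ dot g x = h).
  move=> Ax; rewrite dotDl dotZl.
  have := fP x (AP x Ax); rewrite le_eqVlt => /orP[/eqP fx|fx].
    have gx : dot g x <= h by apply: gF; rewrite FE; split=> //; exact: AP.
    by rewrite fx; split; [lra|move=> e; split=> //; lra].
  have := NA x Ax fx; rewrite mulrBr => H.
  have lt_hb : dot g x + N * dot f x < h + N * b by lra.
  by split=> [|e]; [exact: ltW|move: lt_hb; rewrite e ltxx].
exists (g + N *: f), (h + N * b); split.
  move=> x; rewrite PE => -[m [l [p [Ap l0 l1 ->]]]].
  rewrite -subr_ge0 slack_sum //; apply: sumr_ge0 => i _.
  by rewrite mulr_ge0 // subr_ge0; have [] := slA _ (Ap i).
rewrite GE FE; apply/seteqP; split=> x /=.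
  by move=> [[Px fx] gx]; split=> //; rewrite dotDl dotZl fx gx.
rewrite PE => -[Px]; move: (Px) => -[m [l [p [Ap l0 l1 xE]]]].
rewrite xE => /(conv_slack_eq0 l0 l1 (fun i => (slA _ (Ap i)).1)) z.
rewrite -xE.
have zz i : l i = 0 \/ (dot f (p i) = b /\ dot g (p i) = h).
  by have [|/(slA _ (Ap i)).2] := z i; [left|right].
have fx : dot f x = b.
  apply/eqP; rewrite eq_sym -subr_eq0 xE slack_sum // big1 // => i _.
  by have [->|[-> _]] := zz i; rewrite ?mul0r // subrr mulr0.
have gx : dot g x = h.
  apply/eqP; rewrite eq_sym -subr_eq0 xE slack_sum // big1 // => i _.
  by have [->|[_ ->]] := zz i; rewrite ?mul0r // subrr mulr0.
by [].
Qed.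

(** * Affine hulls, dimension and collinear vertices *)

Lemma sub_aff_hull A : A `<=` aff_hull A.
Proof.
move=> x Ax; exists 1%N, (fun=> 1), (fun=> x).
by split=> //; rewrite ?big_ord1 ?scale1r.
Qed.

(** Affine combinations of points of a line stay on it, so the direction space [U] of the hull lies
    in [<[v]>]. *)
Lemma dim_sub_line F k a v : has_dim F k ->
  (forall y, F y -> exists t : R, y = a + t *: v) -> (k <= 1)%N.
Proof.
move=> [x [U [<- hullE]]] Fl.
have hull_line y : aff_hull F y -> exists t : R, y = a + t *: v.
  move=> [m [l [p [Fp l1 ->]]]].
  have /boolp.choice[t tE] i : exists t : R, p i = a + t *: v by exact: Fl.
  exists (\sum_i l i * t i).
  rewrite -[in RHS](scale1r a) -l1 !scaler_suml -big_split.
  by apply: eq_bigr => i _; rewrite tE scalerDr scalerA.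
have Uhull y : y - x \in U -> aff_hull F y by rewrite hullE.
have [t0 xE] : exists t : R, x = a + t *: v.
  by apply/hull_line/Uhull; rewrite subrr mem0v.
have sub : (U <= <[v]>)%VS.
  apply/subvP => z Uz; have [|t] := hull_line (z + x).
    by apply: Uhull; rewrite addrK.
  move=> /(canRL (addrK x)); rewrite xE opprD addrACA subrr add0r -scalerBl.
  by move=> ->; exact/memvZ/memv_line.
by rewrite (leq_trans (dimvS sub)) // dim_vline leq_b1.
Qed.

(** The base point in [has_dim] is arbitrary in the hull; differences of points of [F] lie in [U],
    so it can be moved to [p]. *)
Lemma has_dimP F k p : has_dim F k -> F p ->
  exists2 U : {vspace 'rV[R]_n}, \dim U = k & forall y, F y -> y - p \in U.
Proof.
move=> [x [U [dU hullE]]] Fp; exists U => // y Fy.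
have FU z : F z -> z - x \in U by move=> /sub_aff_hull; rewrite hullE.
by rewrite -[y](subrK x) -addrA -(opprB p x) memvB // FU.
Qed.

Lemma dim1_line F p q y : has_dim F 1 -> F p -> F q -> q <> p -> F y ->
  exists t : R, y = p + t *: (q - p).
Proof.
move=> dF Fp Fq qp Fy; have [U dU FU] := has_dimP dF Fp.
have : <[q - p]>%VS == U.
  rewrite eqEdim -memvE FU // dU dim_vline subr_eq0.
  by have /eqP -> := qp.
move=> /eqP UE; have := FU y Fy; rewrite -UE => /vlineP[t yE].
by exists t; rewrite -yE addrC subrK.
Qed.

Lemma dim2_plane F p q r y : has_dim F 2 -> F p -> F q -> F r -> q <> p ->
  ~ (exists t : R, r = p + t *: (q - p)) -> F y ->
  exists s t : R, y = p + s *: (q - p) + t *: (r - p).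
Proof.
move=> dF Fp Fq Fr qp rpq Fy; have [U dU FU] := has_dimP dF Fp.
have : basis_of U [:: r - p; q - p].
  rewrite basisEfree dU leqnn andbT free_cons seq1_free subr_eq0 span_seq1.
  rewrite span_cons span_seq1 subv_add -!memvE !FU // !andbT.
  have /eqP -> := qp; rewrite andbT; apply/negP => /vlineP[t rE].
  by apply: rpq; exists t; rewrite -rE addrC subrK.
move=> /andP[/eqP UE _]; have := FU y Fy.
rewrite -UE span_cons span_seq1 => /memv_addP[_ /vlineP[t ->]].
move=> [_ /vlineP[s ->] yE]; exists s, t.
by rewrite -addrA [X in p + X]addrC -yE addrC subrK.
Qed.

Lemma line_dim1 F p q : F p -> F q -> q <> p ->
  (forall y, F y -> exists t : R, y = p + t *: (q - p)) -> has_dim F 1.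
Proof.
move=> Fp Fq qp Fl; exists p, <[q - p]>%VS; split.
  by rewrite dim_vline subr_eq0; have /eqP -> := qp.
apply/seteqP; split=> y /=.
  move=> [m [l [z [Fz l1 ->]]]].
  rewrite -[in X in _ - X](scale1r p) -l1 scaler_suml -sumrB.
  apply: memv_suml => i _; rewrite -scalerBr; apply: memvZ.
  by have [t ->] := Fl _ (Fz i); rewrite addrAC subrr add0r; exact/memvZ/memv_line.
move=> /vlineP[t yE].
exists 2%N, (fun i => if i == ord0 then 1 - t else t),
  (fun i => if i == ord0 then p else q); split.
- by move=> i; case: ifP.
- by rewrite !big_ord_recl big_ord0 /=; lra.
- rewrite !big_ord_recl big_ord0 /= addr0 -[LHS](subrK p) yE.
  by rewrite scalerBr scalerBl scale1r addrC addrA addrAC.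
Qed.

Lemma dot_line f p q (t : R) :
  dot f (p + t *: (q - p)) = dot f p + t * (dot f q - dot f p).
Proof. by rewrite dotDr dotZr dotBr. Qed.

(** One of the three points lies between the other two, and a functional maximal only at that vertex
    forces it to coincide with another of them. The position of [t] relative to 0 and 1 tells which
    one is in the middle. *)
Lemma vertices_collinear P p q r (t : R) :
  vertex P p -> vertex P q -> vertex P r -> r = p + t *: (q - p) ->
  r = p \/ r = q.
Proof.
move=> Pp Pq Pr rE.
have dotr f : dot f r = dot f p + t * (dot f q - dot f p).
  by rewrite rE dot_line.
have [f fP] := vertex_functional Pp; have [g gP] := vertex_functional Pq.
have [h hP] := vertex_functional Pr.
have [fq _] := fP q (vertex_in Pq); have [fr frp] := fP r (vertex_in Pr).
have [gp _] := gP p (vertex_in Pp); have [gr grq] := gP r (vertex_in Pr).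
have [hp hpr] := hP p (vertex_in Pp); have [hq _] := hP q (vertex_in Pq).
clear rE.
have [t0|t0] := leP t 0.
  left; apply: frp; apply/eqP; rewrite eq_le fr /= dotr.
  by rewrite lerDl mulr_le0 // subr_le0.
have [t1|t1] := ltP t 1.
  left; apply/esym; apply: hpr; apply/eqP; rewrite eq_le hp /=.
  have := dotr h; nra.
right; apply: grq; apply/eqP; rewrite eq_le gr /=.
have := dotr g; nra.
Qed.

Lemma finite_argmax (T : choiceType) (D : set T) (k : T -> R) :
  finite_set D -> D !=set0 -> exists2 q, D q & forall r, D r -> k r <= k q.
Proof.
move=> /finite_seqP[s ->]; elim: s => [[x //]|p s IHs _].
have [[r rs]|s0] := pselect ([set` s] !=set0); last first.
  exists p => [|r] /=; rewrite inE ?eqxx // => /orP[/eqP->//|rs].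
  by case: s0; exists r.
have [q qs qmax] := IHs (ex_intro _ r rs).
have [kpq|kqp] := leP (k p) (k q).
  exists q => [|z] /=; rewrite inE; first by rewrite [q \in s]qs orbT.
  by move=> /orP[/eqP->//|]; exact: qmax.
exists p => [|z] /=; rewrite inE ?eqxx // => /orP[/eqP->//|zs].
by rewrite (le_trans (qmax z zs)) // ltW.
Qed.

Lemma dot_plane f p q r (s t : R) :
  dot f (p + s *: (q - p) + t *: (r - p)) =
  dot f p + s * (dot f q - dot f p) + t * (dot f r - dot f p).
Proof. by rewrite dotDr dot_line dotZr dotBr. Qed.

Lemma dim1_sub_face P F G p q : has_dim F 1 -> F `<=` P -> F p -> F q ->
  q <> p -> face P G -> G p -> G q -> F `<=` G.
Proof.
move=> dF FP Fp Fq qp [f [b [fP GE]]] Gp Gq y Fy.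
have [t yE] := dim1_line dF Fp Fq qp Fy.
move: Gp Gq; rewrite GE => -[_ fp] [_ fq]; split; first exact: FP.
by rewrite yE dot_line fp fq subrr mulr0 addr0.
Qed.

(** The functional cutting out [G] takes the same value at three affinely independent points, hence
    on their whole plane. This gives both the minimality of a 2-face and the inclusion of one 2-face
    in another. *)
Lemma dim2_sub_face P F G p q r : has_dim F 2 -> F `<=` P ->
  F p -> F q -> F r -> q <> p -> ~ (exists t : R, r = p + t *: (q - p)) ->
  face P G -> G p -> G q -> G r -> F `<=` G.
Proof.
move=> dF FP Fp Fq Fr qp rpq [f [b [fP GE]]] Gp Gq Gr y Fy.
have [s [t yE]] := dim2_plane dF Fp Fq Fr qp rpq Fy.
move: Gp Gq Gr; rewrite GE => -[_ fp] [_ fq] [_ fr]; split; first exact: FP.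
by rewrite yE dot_plane fp fq fr subrr !mulr0 !addr0.
Qed.

(** * Edges of a 2-face at a vertex *)

Lemma vertex_off_edge P E a p q : face_of_dim P 1 E -> E a -> E p ->
  vertex P a -> vertex P p -> vertex P q -> p <> a -> q <> a -> q <> p -> ~ E q.
Proof.
move=> [_ dE] Ea Ep Pa Pp Pq pa qa qp Eq.
have [t qE] := dim1_line dE Ea Ep pa Eq.
by have [] := vertices_collinear Pa Pp Pq qE.
Qed.

(** The functional supporting [E] equals [b] at [a] and [p] and is smaller at [q], so a negative [t]
    would push its value at [y] above [b]. *)
Lemma edge_side P E a p q y (s t : R) : face P E -> E a -> E p -> P q -> ~ E q ->
  P y -> y = a + s *: (p - a) + t *: (q - a) -> 0 <= t.
Proof.
move=> [f [b [fP EE]]]; rewrite EE => -[_ fa] [_ fp] Pq Eq Py yE.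
have fq : dot f q < b.
  by rewrite lt_neqAle fP // andbT; apply/eqP => fq; apply: Eq.
have := fP y Py; rewrite yE dot_plane fa fp subrr mulr0 addr0 gerDl.
by rewrite nmulr_lle0 // subr_lt0.
Qed.

(** Each of the two edges at [a] fixes the sign of one plane coordinate. The resulting cone turns a
    comparison of [a] with its two neighbours into one with all of [F]. *)
Lemma dim2_cone P F E1 E2 a p q y :
  has_dim F 2 -> F `<=` P -> F a -> F p -> F q ->
  vertex P a -> vertex P p -> vertex P q -> p <> a -> q <> a -> q <> p ->
  face_of_dim P 1 E1 -> E1 a -> E1 p -> face_of_dim P 1 E2 -> E2 a -> E2 q ->
  F y -> exists s t : R, [/\ 0 <= s, 0 <= t &
    y = a + s *: (p - a) + t *: (q - a)].
Proof.
move=> dF FP Fa Fp Fq Pa Pp Pq pa qa qp PE1 E1a E1p PE2 E2a E2q Fy.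
have [|s [t yE]] := dim2_plane dF Fa Fp Fq pa _ Fy.
  by move=> [t /(vertices_collinear Pa Pp Pq)[]].
exists s, t; split=> //.
- apply: (edge_side PE2.1 E2a E2q (vertex_in Pp) _ (FP _ Fy)).
    by apply: (vertex_off_edge PE2 E2a E2q) => // /esym.
  by rewrite yE addrAC.
- apply: (edge_side PE1.1 E1a E1p (vertex_in Pq) _ (FP _ Fy) yE).
  exact: (vertex_off_edge PE1 E1a E1p).
Qed.

(* With [f] supporting [E1] and [h] supporting [a], the second edge at [a]
   carries the point maximizing the slope [(b - f y) / (h a - h y)]. *)
Lemma second_edge P F E1 a p : polytope P -> face_of_dim P 2 F ->
  vertex P a -> face_of_dim P 1 E1 -> E1 a -> E1 p -> F a -> F p -> p <> a ->
  exists E q, [/\ face_of_dim P 1 E, vertex E a, vertex E q, F q &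
    q <> a /\ q <> p].
Proof.
move=> pP [PF dF] Pa [PE1 dE1] E1a E1p Fa Fp pa.
have FP := face_sub PF; have [h ha] := vertex_functional Pa.
have hlt y : F y -> y <> a -> 0 < dot h a - dot h y.
  move=> /FP Py ya; have [hy hya] := ha y Py.
  by rewrite subr_gt0 lt_neqAle hy andbT; apply/eqP => /hya.
move: (pP) PE1 => [A finA PA] [f [b [fP E1E]]].
have [_ fa] : P a /\ dot f a = b by move: E1a; rewrite E1E.
have [_ fp] : P p /\ dot f p = b by move: E1p; rewrite E1E.
(* Were all generators of [F] on [E1], then [F] would lie in the line of [E1], against its dimension
   2. *)
have [r [Ar Fr fr]] : exists r, [/\ A r, F r & dot f r < b].
  apply: contrapT => noA.
  have FE1 : F `<=` E1.
    move=> y Fy; rewrite E1E; split; first exact: FP.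
    apply/eqP; rewrite eq_le fP /=; last exact: FP.
    rewrite -lerN2 -dotNl; move: y Fy; rewrite PA in PF.
    apply: (face_dot_le PF) => x Ax Fx; rewrite dotNl lerN2 leNgt.
    by apply/negP => fx; apply: noA; exists x.
  by have := dim_sub_line dF (fun y Fy => dim1_line dE1 E1a E1p pa (FE1 y Fy)).
have ra : r <> a by move=> ra; move: fr; rewrite ra fa ltxx.
pose slope y := (b - dot f y) / (dot h a - dot h y).
have [q0 [[Aq0 Fq0] q0a] q0max] :
    exists2 q0, (A `&` F `&` [set y | y <> a]) q0 &
    forall y, (A `&` F `&` [set y | y <> a]) y -> slope y <= slope q0.
  apply: finite_argmax; last by exists r.
  by do 2 apply: finite_setIl.
pose rho := slope q0.
have rho0 : 0 < rho.
  apply: lt_le_trans (q0max r _) => //.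
  by rewrite divr_gt0 ?subr_gt0 // -subr_gt0 hlt.
(* Since [rho] is the maximal slope, [g] is maximal on [F] at [a], and a generator other than [a]
   reaches that value exactly when its slope is [rho]. *)
pose g := rho *: h - f.
have gE y : dot g y = rho * dot h y - dot f y by rewrite dotDl dotZl dotNl.
have gF y : F y -> dot g y <= dot g a.
  move: y; rewrite PA in PF; apply: (face_dot_le PF) => y Ay Fy.
  have [->//|ya] := pselect (y = a).
  have := q0max y (conj (conj Ay Fy) ya).
  by rewrite ler_pdivrMr ?hlt // -/rho !gE fa mulrBr; lra.
pose E := [set y | F y /\ dot g y = dot g a].
have FE : face F E by exists g, (dot g a).
have PE : face P E by exact: face_trans FE.
have Eq0 : E q0.
  split=> //; have : slope q0 * (dot h a - dot h q0) = b - dot f q0.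
    by rewrite divfK // gt_eqF // hlt.
  by rewrite -/rho !gE fa mulrBr; lra.
(* [h] is largest at [a], so a generator of [E] minimizing [h] is the far endpoint. *)
have [q [Aq Eq] qmax] : exists2 q, (A `&` E) q &
    forall y, (A `&` E) y -> - dot h y <= - dot h q.
  by apply: finite_argmax; [exact: finite_setIl|exists q0].
have Emax y : E y -> dot (- h) y <= dot (- h) q.
  move: y; rewrite PA in PE; apply: (face_dot_le PE) => y Ay Ey.
  by rewrite !dotNl qmax.
have hqa : dot h q < dot h a.
  have := hlt _ Fq0 q0a; have := qmax q0 (conj Aq0 Eq0); lra.
have qa : q <> a by move=> qa; move: hqa; rewrite qa ltxx.
have fq : dot f q != b.
  apply/eqP => fq; have := Eq.2; rewrite !gE fq fa; nra.
have qap : ~ exists t : R, q = a + t *: (p - a).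
  move=> [t qE]; move: fq; rewrite qE dot_line fa fp subrr mulr0 addr0.
  by rewrite eqxx.
(* In the coordinates given by [p] and [q], the functional [g] agrees at [a] and [q] but is smaller
   at [p]; being constant on [E], it kills the coordinate [s]. *)
have Eline y : E y -> exists t : R, y = a + t *: (q - a).
  move=> [Fy gy]; have [s [t yE]] := dim2_plane dF Fa Fp Eq.1 pa qap Fy.
  exists t; move: gy; rewrite yE dot_plane Eq.2 subrr mulr0 addr0.
  move=> /(canRL (addKr _)); rewrite addNr !gE fa fp => /eqP.
  have /gt_eqF hp := mulr_gt0 rho0 (hlt p Fp pa).
  have -> : rho * dot h p - b - (rho * dot h a - b) =
    - (rho * (dot h a - dot h p)) by rewrite mulrBr; lra.
  rewrite mulrN oppr_eq0 mulf_eq0 hp orbF => /eqP->.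
  by rewrite scale0r addr0.
have Ea : E a by [].
exists E, q; split.
- by split=> //; exact: line_dim1 Ea Eq qa Eline.
- exact: vertex_restrict Pa (face_sub PE) Ea.
- exists (- h), (dot (- h) q); split=> //; apply/seteqP; split=> [y ->//|y /= [Ey]].
  have [t ->] := Eline y Ey; rewrite dot_line !dotNl => ht.
  have -> : t = 1.
    have : (t - 1) * (dot h a - dot h q) = 0 by rewrite mulrBl mulrBr; lra.
    move=> /eqP; rewrite mulf_eq0 !subr_eq0 => /orP[/eqP//|/eqP e].
    by move: hqa; rewrite e ltxx.
  by rewrite scale1r addrC subrK.
- exact: Eq.1.
- by split=> // qp; move: fq; rewrite qp fp eqxx.
Qed.

End Geometry.

(** * Induction and covers in finite orders *)

Lemma finPOrder_up_ind (d : Order.disp_t) (T : finPOrderType d) (Q : T -> Prop) :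
  (forall a, (forall b, (a < b)%O -> Q b) -> Q a) -> forall a, Q a.
Proof.
move=> IH a; have [m] := ubnP #|[pred v | (a < v)%O]|.
elim: m a => // m IHm a; rewrite ltnS => am; apply: IH => b ab; apply: IHm.
apply: leq_trans am; apply: proper_card; apply/properP; split.
  by apply/fintype.subsetP => v; rewrite !inE; exact: lt_trans.
by exists b; rewrite !inE ?ltxx.
Qed.

Lemma finPOrder_down_ind (d : Order.disp_t) (T : finPOrderType d)
    (Q : T -> Prop) :
  (forall a, (forall b, (b < a)%O -> Q b) -> Q a) -> forall a, Q a.
Proof. exact: (@finPOrder_up_ind _ T^d). Qed.

Lemma lower_cover (d : Order.disp_t) (T : finPOrderType d) (a b : T) :
  (a < b)%O -> exists2 p, (a <= p)%O & covers b p.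
Proof.
elim/finPOrder_up_ind: a => a IH ab.
have [[t [at_ tb]]|nt] := pselect (exists t, (a < t)%O /\ (t < b)%O).
  have [p tp bp] := IH t at_ tb; exists p => //.
  exact: le_trans (ltW at_) tp.
by exists a => //; split=> // t at_b; apply: nt; exists t.
Qed.

Lemma covers_dual (d : Order.disp_t) (L : porderType d) (a b : L) :
  covers (a : L^d) b <-> covers b a.
Proof. by split=> -[ab nt]; split=> // z [/[swap]]; move=> ? ?; apply: (nt z). Qed.

(** * Translation between the lattice and the graph of the polytope *)

Section Hasse.
Variables (R : realType) (n : nat) (P : set 'rV[R]_n) (c : 'rV[R]_n).
Variables (d : Order.disp_t) (L : finLatticeType d) (phi : L -> 'rV[R]_n).
Hypotheses (pP : polytope P) (sP : simple P) (gP : generic P c).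
Hypothesis iso : hasse_iso P c phi.
Implicit Types (E F K : set 'rV[R]_n) (a b p q g u w : L).

Lemma hasse_vertex a : vertex P (phi a).
Proof. by have [[f _ _] _] := iso; exact: f. Qed.

Lemma hasse_inj : injective phi.
Proof. by have [[_ inj _] _] := iso => a b e; apply: inj; rewrite ?in_setT. Qed.

Lemma hasse_neq a b : a <> b -> phi a <> phi b.
Proof. by move=> ab /hasse_inj. Qed.

Lemma hasse_surj (v : 'rV[R]_n) : vertex P v -> exists a, phi a = v.
Proof. by have [[_ _ s] _] := iso => /s[a _ <-]; exists a. Qed.

Lemma covers_edge a b : covers b a ->
  exists E, [/\ face_of_dim P 1 E, vertex E (phi a), vertex E (phi b),
    E (phi a) & E (phi b)].
Proof.
have [_ h] := iso => /h[E [PE va vb _]].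
by exists E; split=> //; exact: vertex_in.
Qed.

Lemma covers_dot a b : covers b a -> dot c (phi a) < dot c (phi b).
Proof. by have [_ h] := iso => /h[E []]. Qed.

Lemma covers_neq a b : covers b a -> b <> a.
Proof. by move=> [ab _] e; rewrite e ltxx in ab. Qed.

Lemma covers_lt_neq a b g : covers b a -> (a < g)%O -> g <> b -> ~ (g <= b)%O.
Proof.
move=> [_ nt] ag gb le_gb; apply: (nt g); split=> //.
by rewrite lt_neqAle le_gb andbT; apply/eqP.
Qed.

Lemma hasse_sink F a : F `<=` P -> F (phi a) ->
  (forall y, F y -> dot c y <= dot c (phi a)) -> sink c F (phi a).
Proof.
by move=> FP Fa m; split=> //; exact: vertex_restrict (hasse_vertex a) FP Fa.
Qed.

Lemma sink_inj F a b : sink c F (phi a) -> sink c F (phi b) -> a = b.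
Proof.
move=> [/vertex_in Fa am] [/vertex_in Fb bm]; apply: contrapT => ab.
apply: (gP (hasse_vertex a) (hasse_vertex b) (hasse_neq ab)).
by apply/eqP; rewrite eq_le am // bm.
Qed.

(** * Climbing along the sides of a 2-face *)

(** The second edge of [F] at [a] either ascends, giving [q], or descends like the one to [p]; in
    the latter case [F] lies in a cone along which [c] does not increase. *)
Lemma face2_next F p a : face_of_dim P 2 F -> covers a p ->
  F (phi p) -> F (phi a) ->
  sink c F (phi a) \/ exists2 q, covers q a & F (phi q).
Proof.
move=> PF ap Fp Fa; have FP := face_sub PF.1.
have [E1 [PE1 _ _ E1p E1a]] := covers_edge ap.
have pa := nesym (hasse_neq (covers_neq ap)).
have [E [q [PE Ea Eq Fq [qa qp]]]] :=
  second_edge pP PF (hasse_vertex a) PE1 E1a E1p Fa Fp pa.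
have Pq : vertex P q := face_trans pP PE.1 Eq.
have [b bq] := hasse_surj Pq; rewrite -bq in qa qp Eq Fq Pq *.
have [lt_ab|le_ba] := ltP (dot c (phi a)) (dot c (phi b)).
  by right; exists b => //; apply/iso.2; exists E.
left; apply: hasse_sink => // y Fy.
have [s [t [s0 t0 ->]]] := dim2_cone PF.2 FP Fa Fp Fq (hasse_vertex a)
  (hasse_vertex p) Pq pa qa qp PE1 E1a E1p PE (vertex_in Ea) (vertex_in Eq) Fy.
have := covers_dot ap; rewrite dot_plane; nra.
Qed.

Lemma face2_two_lower F a p q : face_of_dim P 2 F -> covers a p -> covers a q ->
  p <> q -> F (phi a) -> F (phi p) -> F (phi q) -> sink c F (phi a).
Proof.
move=> PF ap aq pq Fa Fp Fq; have FP := face_sub PF.1.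
have [E1 [PE1 _ _ E1p E1a]] := covers_edge ap.
have [E2 [PE2 _ _ E2q E2a]] := covers_edge aq.
apply: hasse_sink => // y Fy.
have [s [t [s0 t0 ->]]] := dim2_cone PF.2 FP Fa Fp Fq (hasse_vertex a)
  (hasse_vertex p) (hasse_vertex q) (nesym (hasse_neq (covers_neq ap)))
  (nesym (hasse_neq (covers_neq aq))) (nesym (hasse_neq pq))
  PE1 E1a E1p PE2 E2a E2q Fy.
have := covers_dot ap; have := covers_dot aq; rewrite dot_plane; nra.
Qed.

Lemma covers_noncollinear a p q : p <> a -> q <> a -> q <> p ->
  ~ (exists t : R, phi q = phi a + t *: (phi p - phi a)).
Proof.
move=> pa qa qp [t qE].
have [] := vertices_collinear (hasse_vertex a) (hasse_vertex p)
  (hasse_vertex q) qE; exact: hasse_neq.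
Qed.

(** This is simplicity for [i = 2], applied to the edges from [a] to [p] and [q]; they differ
    because the line of an edge carries only two vertices of [P]. *)
Lemma face2_span a p q : covers p a -> covers q a -> p <> q ->
  exists F, [/\ face_of_dim P 2 F, F (phi a), F (phi p) & F (phi q)].
Proof.
move=> pa qa pq.
have [E1 [PE1 _ _ E1a E1p]] := covers_edge pa.
have [E2 [PE2 _ _ E2a E2q]] := covers_edge qa.
have E12 : E1 <> E2.
  move=> e; rewrite -e in E2q.
  apply: (vertex_off_edge PE1 E1a E1p) E2q; try exact: hasse_vertex.
  - exact/hasse_neq/covers_neq.
  - exact/hasse_neq/covers_neq.
  - exact/hasse_neq/nesym.
have [||F [PF Fa FE]] := sP (hasse_vertex a) (i := 2) (S := [set E1; E2]).
- by move=> E [] ->.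
(* An explicit bijection from the indices 0 and 1 onto the two edges gives the cardinality. *)
- pose e i := if i == 0%N then E1 else E2.
  suff <- : e @` `I_2 = [set E1; E2].
    apply: inj_card_eq => i j /set_mem i2 /set_mem j2.
    by case: i j i2 j2 => [|[|//]] [|[|//]] _ _ //= e12; case: E12.
  apply/seteqP; split=> [_ [[|i] _ <-]|_ [] ->]; [by left|by right|..].
    by exists 0%N.
  by exists 1%N.
- by exists F; split=> //; [apply: (FE E1)|apply: (FE E2)] => //; [left|right].
Qed.

(** Repeated use of [face2_next] rises strictly in a finite order, so it stops, and it can only stop
    at the sink. *)
Lemma face2_climb F p a : face_of_dim P 2 F -> covers a p ->
  F (phi p) -> F (phi a) -> exists2 w, sink c F (phi w) & (a <= w)%O.
Proof.
move=> PF; elim/finPOrder_up_ind: a p => a IH p ap Fp Fa.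
have [sa|[q qa Fq]] := face2_next PF ap Fp Fa; first by exists a.
have [w sw qw] := IH q qa.1 a qa Fa Fq; exists w => //.
exact: le_trans (ltW qa.1) qw.
Qed.

Lemma face2_le_sink F w p a : face_of_dim P 2 F -> sink c F (phi w) ->
  covers a p -> F (phi p) -> F (phi a) -> (a <= w)%O.
Proof.
move=> PF sw ap Fp Fa; have [w' sw' aw'] := face2_climb PF ap Fp Fa.
by rewrite (sink_inj sw sw').
Qed.

(** * Joins as sinks of 2-faces *)

(** Named so that the hypothesis of the downward induction on [u] can be passed to the next two
    lemmas. *)
Definition join_is_sink u := forall F (x y : L), face_of_dim P 2 F ->
  F (phi u) -> F (phi x) -> F (phi y) -> covers x u -> covers y u -> x <> y ->
  sink c F (phi (Order.join x y)).

Lemma no_escape u F w p a g : (forall v, (u < v)%O -> join_is_sink v) ->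
  face_of_dim P 2 F -> sink c F (phi w) -> (u <= p)%O -> covers a p ->
  F (phi p) -> F (phi a) -> covers g a -> (g <= w)%O -> F (phi g).
Proof.
move=> IHu PF sw; elim/finPOrder_up_ind: a p g => a IH p g up ap Fp Fa ga gw.
have [sa|[b ba Fb]] := face2_next PF ap Fp Fa.
  by move: gw; rewrite (sink_inj sw sa) (lt_geF ga.1).
have [<-//|bg] := pselect (b = g).
have ua := le_lt_trans up ap.1.
have [K [PK Ka Kb Kg]] := face2_span ba ga bg.
have sK := IHu a ua K b g PK Ka Kb Kg ba ga bg.
have bgw : (Order.join b g <= w)%O.
  by rewrite leUx gw (face2_le_sink PF sw ba).
have [sb|[g' g'b Kg']] := face2_next PK ba Ka Kb.
  exfalso; apply: (covers_lt_neq ba ga.1 (nesym bg)).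
  by rewrite (sink_inj sb sK) leUr.
(* Inner induction at [b], with [a] as its lower neighbour in [F]. *)
have Fg' : F (phi g').
  apply: (IH b ba.1 a g' (ltW ua) ba Fa Fb g'b).
  exact: le_trans (face2_le_sink PK sK g'b Kb Kg') bgw.
(* [K] shares the non-collinear vertices [a], [b], [g'] with [F], so [K] is contained in [F] and [g]
   lies in [F]. *)
apply: (dim2_sub_face PK.2 (face_sub PK.1) Ka Kb Kg' _ _ PF.1 Fa Fb Fg' Kg).
  exact/hasse_neq/covers_neq.
apply: covers_noncollinear; try exact: covers_neq.
by move=> e; have := lt_trans ba.1 g'b.1; rewrite e ltxx.
Qed.

(** Descend from [v] to [x] by lower covers and let [no_escape] carry membership in [F] back up. It
    needs a lower neighbour inside [F], hence the second conjunct; at [v = x] that neighbour is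
    [u]. *)
Lemma interval_sub_face u F w (x : L) :
  (forall v, (u < v)%O -> join_is_sink v) ->
  face_of_dim P 2 F -> sink c F (phi w) -> covers x u ->
  F (phi u) -> F (phi x) -> forall v, (x <= v)%O -> (v <= w)%O ->
  F (phi v) /\ exists p, [/\ (u <= p)%O, covers v p & F (phi p)].
Proof.
move=> IHu PF sw xu Fu Fx; elim/finPOrder_down_ind => v IH xv vw.
have [<-|/eqP nxv] := pselect (x = v); first by split=> //; exists u.
have [|p xp vp] := lower_cover (a := x) (b := v); first by rewrite lt_neqAle nxv.
have [Fp [q [uq pq Fq]]] := IH p vp.1 xp (le_trans (ltW vp.1) vw).
split; first exact: (no_escape IHu PF sw uq pq Fq Fp vp vw).
by exists p; split=> //; exact: le_trans uq (ltW pq.1).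
Qed.

Lemma join_sink u : join_is_sink u.
Proof.
elim/finPOrder_up_ind: u => u IHu F x y PF Fu Fx Fy xu yu xy.
have [w sw xw] := face2_climb PF xu Fu Fx.
have yw := face2_le_sink PF sw yu Fu Fy.
set z := Order.join x y.
have zw : (z <= w)%O by rewrite leUx xw.
have xz : (x < z)%O.
  rewrite lt_neqAle leUl andbT; apply/eqP => e.
  by apply: (covers_lt_neq xu yu.1 (nesym xy)); rewrite e leUr.
have yz : (y < z)%O.
  rewrite lt_neqAle leUr andbT; apply/eqP => e.
  by apply: (covers_lt_neq yu xu.1 xy); rewrite e leUl.
have [p xp zp] := lower_cover xz; have [q yq zq] := lower_cover yz.
have inx := interval_sub_face IHu PF sw xu Fu Fx.
have iny := interval_sub_face IHu PF sw yu Fu Fy.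
have [Fz _] := inx z (ltW xz) zw.
have [Fp _] := inx p xp (le_trans (ltW zp.1) zw).
have [Fq _] := iny q yq (le_trans (ltW zq.1) zw).
(* If [p = q], this element would be an upper bound of [x] and [y] strictly below their join. *)
apply: (face2_two_lower PF zp zq _ Fz Fp Fq) => pq.
by have := lt_geF zp.1; rewrite leUx xp pq yq.
Qed.

(** * Smallest faces and pseudo-joins *)

(** Serves the degenerate case [x = y]. A functional [h] maximal only at [b] bounds the line
    parameter by 1, and [c] increases with that parameter. *)
Lemma edge_sink E a b : face_of_dim P 1 E -> covers b a ->
  E (phi a) -> E (phi b) -> sink c E (phi b).
Proof.
move=> PE ba Ea Eb; have EP := face_sub PE.1.
apply: hasse_sink => // y Ey.
have [t yE] := dim1_line PE.2 Ea Eb (hasse_neq (covers_neq ba)) Ey.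
have [h hb] := vertex_functional (hasse_vertex b).
have [ha hab] := hb _ (EP _ Ea).
have lt_h : dot h (phi a) < dot h (phi b).
  rewrite lt_neqAle ha andbT; apply/eqP => /hab/hasse_inj/esym.
  exact: covers_neq.
have [] := hb _ (EP _ Ey); rewrite yE !dot_line => ht _.
have := covers_dot ba; clear yE; nra.
Qed.

Lemma pseudo_join_join F u (x y : L) : face_of_dim P 2 F ->
  F (phi u) -> F (phi x) -> F (phi y) -> covers x u -> covers y u ->
  pseudo_join P c (phi u) (phi x) (phi y) (phi (Order.join x y)).
Proof.
move=> PF Fu Fx Fy xu yu; have [<-|xy] := pselect (x = y).
  (* When [x = y], the smallest face is the edge from [u] to [x]; otherwise it is [F] itself. *)
  have [E [PE _ _ Eu Ex]] := covers_edge xu.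
  exists E; last by rewrite joinxx; exact: edge_sink PE xu Eu Ex.
  split; [exact: PE.1|by move=> _ [[]|] ->|move=> G PG sub].
  apply: (dim1_sub_face PE.2 (face_sub PE.1) Eu Ex _ PG).
  - exact/hasse_neq/covers_neq.
  - by apply: sub; left; left.
  - by apply: sub; right.
exists F; last exact: (join_sink PF Fu Fx Fy).
split; [exact: PF.1|by move=> _ [[]|] ->|move=> G PG sub].
apply: (dim2_sub_face PF.2 (face_sub PF.1) Fu Fx Fy _ _ PG).
- exact/hasse_neq/covers_neq.
- by apply: covers_noncollinear; [exact: covers_neq..|exact: nesym].
- by apply: sub; left; left.
- by apply: sub; left; right.
- by apply: sub; right.
Qed.
End Hasse.

(** * Reversal of the cost vector and of the order *)

Lemma sink_opp (R : realType) (n : nat) (c : 'rV[R]_n) F s :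
  sink (- c) F s -> source c F s.
Proof. by move=> [Fs h]; split=> // x /h; rewrite !dotNl lerN2. Qed.

Lemma hasse_iso_dual (R : realType) (n : nat) (P : set 'rV[R]_n) (c : 'rV[R]_n)
    (d : Order.disp_t) (L : finLatticeType d) (phi : L -> 'rV[R]_n) :
  hasse_iso P c phi -> hasse_iso P (- c) (phi : L^d -> 'rV[R]_n).
Proof.
move=> [bij h]; split=> // a b; split.
  move=> /covers_dual/h[E [PE vb va ba]].
  by exists E; split=> //; rewrite !dotNl ltrN2.
move=> [E [PE va vb]]; rewrite !dotNl ltrN2 => ba.
by apply/covers_dual/h; exists E.
Qed.

Theorem theorem4p6 (R : realType) (n : nat) (P : set 'rV[R]_n) (c : 'rV[R]_n)
    (d : Order.disp_t) (L : finLatticeType d) (phi : L -> 'rV[R]_n) :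
  polytope P -> simple P -> generic P c -> hasse_iso P c phi ->
  (forall (F : set 'rV[R]_n) (u x y : L),
     face_of_dim P 2 F -> source c F (phi u) ->
     F (phi x) -> F (phi y) -> covers x u -> covers y u ->
     pseudo_join P c (phi u) (phi x) (phi y) (phi (Order.join x y))) /\
  (forall (F : set 'rV[R]_n) (v x y : L),
     face_of_dim P 2 F -> sink c F (phi v) ->
     F (phi x) -> F (phi y) -> covers v x -> covers v y ->
     pseudo_meet P c (phi v) (phi x) (phi y) (phi (Order.meet x y))).
Proof.
move=> pP sP gP iso; split=> F u x y PF [/vertex_in Fu _] Fx Fy xu yu.
  exact: (pseudo_join_join pP sP gP iso PF).
have gP' : generic P (- c).
  by move=> v w Pv Pw vw; rewrite !dotNl => /oppr_inj; exact: gP.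
have xu' : covers (x : L^d) u by apply/covers_dual.
have yu' : covers (y : L^d) u by apply/covers_dual.
(* The join of [L^d] is the meet of [L], and a sink for [- c] is a source for [c]. *)
have [G sG /sink_opp sc] :=
  pseudo_join_join pP sP gP' (hasse_iso_dual iso) PF Fu Fx Fy xu' yu'.
by exists G.
Qed.
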